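(* Let $m\geq2$, $u=4t/(1+t)^{2}$, $z=(1+t)x/(1-t)$, and \[ c_{m,j,k}=2\sum_{l=1}^{k}{l+jm-1 \choose l-1}{jm-1 \choose k-l},\qquad c_{m,j,k}^{\prime}=2\sum_{l=1}^{k}{l+jm \choose l-1}{jm \choose k-l}. \] Then (a) \[ \frac{1}{1-t}+\frac{1+t}{2(1-t)}\sum_{n=1}^{\infty}P_{12\cdots m,n}^{\mathrm{ipk}}(s,u)z^{n}=\sum_{n=0}^{\infty}\Bigg(\frac{2tx}{(1-t)^{2}}+\frac{2t(s-1)z^{m}}{(1-t^{2})(1-(s-1)\sum_{l=1}^{m-1}z^{l})}\Bigg)^{*\langle n\rangle}, \] (b) \[ \frac{1}{1-t}+\frac{1+t}{2(1-t)}\sum_{n=1}^{\infty}P_{12\cdots m,n}^{\mathrm{ipk}}(u)z^{n}=\sum_{n=0}^{\infty}\left(\frac{2tz(1-z^{m-1})}{(1-t^{2})(1-z^{m})}\right)^{*\langle n\rangle}, \] and (c) \[ \frac{1}{1-t}+\frac{1+t}{2(1-t)}\sum_{n=1}^{\infty}P_{12\cdots m,n}^{\mathrm{ipk}}(u)z^{n}=1+\sum_{k=1}^{\infty}\left[1-2kx+\sum_{j=1}^{\infty}(c_{m,j,k}x^{jm}-c_{m,j,k}^{\prime}x^{jm+1})\right]^{-1}t^{k}. \]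
   Context: $\mathfrak{S}_n$ is the set of permutations of $[n]$ in one-line notation. $\operatorname{std}$ of a sequence of distinct integers replaces its letters by $1,2,\dots$ in order of size. For $\pi\in\mathfrak{S}_n$ and $\sigma\in\mathfrak{S}_m$, $\operatorname{occ}_\sigma(\pi)$ is the number of $i\in[n-m+1]$ with $\operatorname{std}(\pi_i\cdots\pi_{i+m-1})=\sigma$. A peak of $\pi$ is $i\in\{2,\dots,n-1\}$ with $\pi_{i-1}<\pi_i>\pi_{i+1}$; $\operatorname{pk}$ counts peaks and $\operatorname{ipk}(\pi)=\operatorname{pk}(\pi^{-1})$. $P_{\sigma,n}^{\mathrm{ipk}}(s,t)=\sum_{\pi\in\mathfrak{S}_n}s^{\operatorname{occ}_\sigma(\pi)}t^{\operatorname{ipk}(\pi)+1}$ for $n\ge1$ and $P_{\sigma,n}^{\mathrm{ipk}}(t)=P_{\sigma,n}^{\mathrm{ipk}}(0,t)$. In (a),(b) the right sides are computed in formal power series with ordinary multiplication in $s,x$ and the Hadamard product in $t$: $(\sum_n a_nt^n)*(\sum_n b_nt^n)=\sum_n a_nb_nt^n$; $f^{*\langle n\rangle}$ is the $n$-fold Hadamard product, $f^{*\langle0\rangle}=1/(1-t)$. In (c), $[\cdot]^{-1}$ is the ordinary inverse in $\mathbb{Q}[[x]]$. Other expressions use ordinary multiplication. *)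

(* Defs.v *)
From HB Require Import structures.
From mathcomp Require Import all_boot all_order all_algebra all_fingroup.
From mathcomp Require Import boolp classical_sets functions cardinality fsbigop.

Set Implicit Arguments.
Unset Strict Implicit.
Unset Printing Implicit Defensive.

Import GRing.Theory.

Section Permutations.
Local Open Scope nat_scope.

(* Elements of 'S_n permute {0, ..., n-1}; letters are shifted so that they
   range over {1, ..., n}. *)
Definition one_line n (p : 'S_n) : seq nat := [seq (p i).+1 | i <- enum 'I_n].

(* The letter p_i, for a 1-based position i. *)
Definition letter n (p : 'S_n) (i : nat) : nat := nth 0 (one_line p) i.-1.

(* Only meaningful on words with distinct letters. *)
Definition std (w : seq nat) : seq nat :=
  [seq (index a (sort leq w)).+1 | a <- w].

(* With truncated subtraction, n.+1 - m = max(n - m + 1, 0). *)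
Definition occ m (s : 'S_m) n (p : 'S_n) : nat :=
  #|[set i : 'I_(n.+1 - m) | std (take m (drop i (one_line p))) == one_line s]|.

Definition is_peak n (p : 'S_n) (i : nat) : bool :=
  (letter p i.-1 < letter p i) && (letter p i.+1 < letter p i).

Definition pk n (p : 'S_n) : nat := count (is_peak p) (index_iota 2 n).

Definition ipk n (p : 'S_n) : nat := pk (p^-1)%g.

Definition coef_c (m j k : nat) : nat :=
  2 * \sum_(1 <= l < k.+1) 'C(l + j * m - 1, l - 1) * 'C(j * m - 1, k - l).

Definition coef_c' (m j k : nat) : nat :=
  2 * \sum_(1 <= l < k.+1) 'C(l + j * m, l - 1) * 'C(j * m, k - l).

End Permutations.

Local Open Scope ring_scope.

(* The polynomial P_{sigma,n}^{ipk}(s,t), evaluated at two elements of a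
   commutative ring; P_{sigma,n}^{ipk}(t) is the case s = 0, with 0 ^+ 0 = 1. *)
Definition P_ipk (A : comNzRingType) m (sg : 'S_m) (n : nat) (s t : A) : A :=
  \sum_(p : 'S_n) s ^+ occ sg p * t ^+ (ipk p).+1.

Record fps (R : Type) := Fps { fps_coef :> nat -> R }.

HB.instance Definition _ (R : Type) := gen_eqMixin (fps R).
HB.instance Definition _ (R : Type) := gen_choiceMixin (fps R).

Lemma fpsP (R : Type) (f g : fps R) : f =1 g <-> f = g.
Proof. by split=> [|-> //]; case: f g => [f] [g] /= /funext ->. Qed.

Section FpsRing.
Variable R : comNzRingType.
Implicit Types f g h : fps R.

Definition fpsC (c : R) : fps R := Fps (fun n => if n == 0%N then c else 0).
Definition fpsX : fps R := Fps (fun n => (n == 1%N)%:R).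

Definition fps_add f g := Fps (fun n => f n + g n).
Definition fps_opp f := Fps (fun n => - f n).
Definition fps_mul f g := Fps (fun n => \sum_(i < n.+1) f i * g (n - i)%N).

Fact fps_addA : associative fps_add.
Proof. by move=> f g h; apply/fpsP=> n /=; rewrite addrA. Qed.
Fact fps_addC : commutative fps_add.
Proof. by move=> f g; apply/fpsP=> n /=; rewrite addrC. Qed.
Fact fps_add0 : left_id (fpsC 0) fps_add.
Proof. by move=> f; apply/fpsP=> n /=; rewrite if_same add0r. Qed.
Fact fps_addN : left_inverse (fpsC 0) fps_opp fps_add.
Proof. by move=> f; apply/fpsP=> n /=; rewrite addNr if_same. Qed.

HB.instance Definition _ := GRing.isZmodule.Build (fps R)
  fps_addA fps_addC fps_add0 fps_addN.

Fact fps_mulE_rev f g n :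
  fps_mul f g n = \sum_(i < n.+1) f (n - i)%N * g i.
Proof.
rewrite /= (reindex_inj rev_ord_inj) /=.
by apply: eq_bigr => j _; rewrite (sub_ordK j).
Qed.

Fact fps_mulC : commutative fps_mul.
Proof.
move=> f g; apply/fpsP=> n; rewrite fps_mulE_rev /=.
by apply: eq_bigr => i _; rewrite mulrC.
Qed.

Fact fps_mulA : associative fps_mul.
Proof.
have mulE f g n : fps_mul f g n = \sum_(i < n.+1) f i * g (n - i)%N by [].
move=> p q r; apply/fpsP=> i; rewrite mulE fps_mulE_rev.
pose coef3 j k := p j * (q (i - j - k)%N * r k).
transitivity (\sum_(j < i.+1) \sum_(k < i.+1 | (k <= i - j)%N) coef3 j k).
  apply: eq_bigr => j _; rewrite fps_mulE_rev big_distrr /=.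
  by rewrite (big_ord_narrow_leq (leq_subr _ _)).
rewrite (exchange_big_dep predT) //=; apply: eq_bigr => k _.
transitivity (\sum_(j < i.+1 | (j <= i - k)%N) coef3 j k).
  apply: eq_bigl => j; rewrite -ltnS -(ltnS j) -!subSn ?leq_ord //.
  by rewrite -subn_gt0 -(subn_gt0 j) -!subnDA addnC.
rewrite (big_ord_narrow_leq (leq_subr _ _)) big_distrl /=.
by apply: eq_bigr => j _; rewrite /coef3 -!subnDA addnC mulrA.
Qed.

Fact fps_mul1 : left_id (fpsC 1) fps_mul.
Proof.
move=> f; apply/fpsP=> n /=; rewrite big_ord_recl /= subn0 mul1r.
by rewrite big1 ?addr0 // => i _; rewrite mul0r.
Qed.

Fact fps_mulD : left_distributive fps_mul fps_add.
Proof.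
move=> f g h; apply/fpsP=> n /=; rewrite -big_split /=.
by apply: eq_bigr => i _; rewrite mulrDl.
Qed.

Fact fps1_neq0 : fpsC 1 != 0.
Proof.
by apply/eqP => /fpsP /(_ 0%N) /= /eqP; apply/negP; exact: oner_neq0.
Qed.

HB.instance Definition _ := GRing.Zmodule_isComNzRing.Build (fps R)
  fps_mulA fps_mulC fps_mul1 fps_mulD fps1_neq0.

Lemma fps0E n : (0 : fps R) n = 0. Proof. by rewrite /= if_same. Qed.
Lemma fps1E n : (1 : fps R) n = (n == 0%N)%:R. Proof. by case: n. Qed.
Lemma fpsDE f g n : (f + g) n = f n + g n. Proof. by []. Qed.
Lemma fpsNE f n : (- f) n = - f n. Proof. by []. Qed.
Lemma fpsME f g n : (f * g) n = \sum_(i < n.+1) f i * g (n - i)%N.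
Proof. by []. Qed.

Lemma fpsXnE m n : (fpsX ^+ m : fps R) n = (n == m)%:R.
Proof.
elim: m n => [|m IHm] n; first by rewrite expr0 fps1E.
rewrite exprS fpsME; case: n => [|n].
  by rewrite big_ord1 mul0r.
rewrite big_ord_recl mul0r add0r big_ord_recl mul1r IHm subSS subn0.
by rewrite big1 ?addr0 // => i _; rewrite mul0r.
Qed.

Lemma fps_sumE (I : Type) (r : seq I) (P : pred I) (F : I -> fps R) n :
  (\sum_(i <- r | P i) F i) n = \sum_(i <- r | P i) F i n.
Proof.
by apply: (big_morph (fun f : fps R => f n)) => //; exact: fps0E.
Qed.

Fact fpsC_is_zmod_morphism : zmod_morphism fpsC.
Proof. by move=> a b; apply/fpsP=> -[|n]; rewrite fpsDE fpsNE //= subr0. Qed.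
HB.instance Definition _ :=
  GRing.isZmodMorphism.Build R (fps R) fpsC fpsC_is_zmod_morphism.

Fact fpsC_is_monoid_morphism : monoid_morphism fpsC.
Proof.
split=> // a b; apply/fpsP=> n; rewrite fpsME big_ord_recl big1 => [|i _].
  by rewrite addr0 subn0 /=; case: n => //= n; rewrite mulr0.
by rewrite /= mul0r.
Qed.
HB.instance Definition _ :=
  GRing.isMonoidMorphism.Build R (fps R) fpsC fpsC_is_monoid_morphism.

Lemma fps_exp_low f n k : f 0%N = 0 -> (n < k)%N -> (f ^+ k) n = 0.
Proof.
move=> f0; elim: k n => // k IHk n ltnk; rewrite exprS fpsME.
rewrite big_ord_recl f0 mul0r add0r big1 // => i _; rewrite IHk ?mulr0 // lift0.
case: n ltnk i => [|n] ltnk [i lti] //=.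
by rewrite subSS (leq_ltn_trans (leq_subr _ _)).
Qed.

End FpsRing.
Arguments fpsX {R}.

Section FpsUnit.
Variable R : comUnitRingType.
Implicit Types f g : fps R.

(* With a := f 0 and g := 1 - a^-1 f, the inverse of f = a (1 - g) is
   a^-1 (1 + g + g^2 + ...), and g ^+ i only contributes in degrees >= i. *)
Definition fps_unit : pred (fps R) := fun f => f 0%N \is a GRing.unit.
Definition fps_inv f : fps R :=
  if fps_unit f then
    Fps (fun n => (f 0%N)^-1 *
      (\sum_(i < n.+1) (1 - fpsC (f 0%N)^-1 * f) ^+ i : fps R) n)
  else f.

Fact fps_mulVr : {in fps_unit, left_inverse 1 fps_inv *%R}.
Proof.
move=> f; rewrite unfold_in => Uf; rewrite /fps_inv {1}/fps_unit Uf.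
set a := f 0%N; set g := 1 - fpsC a^-1 * f.
have CfE n h : (fpsC a^-1 * h : fps R) n = a^-1 * h n.
  rewrite fpsME big_ord_recl big1 => [|i _]; first by rewrite addr0 subn0.
  by rewrite /= mul0r.
have g0 : g 0%N = 0.
  by rewrite fpsDE fpsNE CfE -/a mulVr // subrr.
apply/fpsP=> n.
transitivity ((fpsC a^-1 * (\sum_(i < n.+1) g ^+ i) * f) n).
  rewrite [LHS]fpsME [RHS]fpsME; apply: eq_bigr => i _; congr (_ * _).
  rewrite CfE /=; congr (_ * _); rewrite !fps_sumE.
  rewrite (big_ord_widen n.+1 (fun j => (g ^+ j) i)) ?ltn_ord //.
  rewrite big_mkcond /=; apply: eq_bigr => j _.
  by case: ltnP => // ltij; rewrite fps_exp_low.
have -> : fpsC a^-1 * (\sum_(i < n.+1) g ^+ i) * f = 1 - g ^+ n.+1.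
  have Eg : 1 - g = fpsC a^-1 * f by rewrite /g subKr.
  by rewrite mulrAC -Eg -[1 - g]opprB mulNr -subrX1 opprB.
by rewrite fpsDE fpsNE fps_exp_low // subr0.
Qed.

Fact fps_unitP f g : g * f = 1 -> fps_unit f.
Proof.
move=> /fpsP /(_ 0%N); rewrite fpsME big_ord1 fps1E /= => gf.
by apply/unitrPr; exists (g 0%N); rewrite mulrC.
Qed.

Fact fps_inv_out : {in [predC fps_unit], fps_inv =1 id}.
Proof.
move=> f; rewrite inE /fps_inv => /negbTE; rewrite unfold_in => Uf.
by rewrite /fps_unit Uf.
Qed.

HB.instance Definition _ := GRing.ComNzRing_hasMulInverse.Build (fps R)
  fps_mulVr fps_unitP fps_inv_out.

Lemma fps_unitE f : (f \is a GRing.unit) = (f 0%N \is a GRing.unit).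
Proof. by []. Qed.

End FpsUnit.

Section FpsSum.
Local Open Scope classical_set_scope.

Definition fps_summable (R : comNzRingType) (a : nat) (F : nat -> fps R) :=
  forall i, finite_set [set n | (a <= n)%N /\ F n i != 0].

(* The formal sum of F a, F a.+1, ...; a coefficient at which F is not
   summable gets the junk value 0. *)
Definition fps_sum (R : comNzRingType) (a : nat) (F : nat -> fps R) : fps R :=
  Fps (fun i => \sum_(n \in [set n | (a <= n)%N]) F n i).

(* Bivariate series: all coefficients of both variables are summed
   separately. *)
Definition fps_summable2 (R : comNzRingType) (a : nat)
    (F : nat -> fps (fps R)) :=
  forall k, fps_summable a (fun n => F n k).

Definition fps_sum2 (R : comNzRingType) (a : nat)
    (F : nat -> fps (fps R)) : fps (fps R) :=
  Fps (fun k => fps_sum a (fun n => F n k)).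

End FpsSum.

(* The Hadamard product is taken in the outermost variable; it is associative
   with unit 1/(1-t), so the n-fold product is an n-fold iteration on it. *)
Definition hadamard (R : comNzRingType) (f g : fps R) : fps R :=
  Fps (fun k => f k * g k).

Definition hadamard_exp (R : comUnitRingType) (f : fps R) (n : nat) : fps R :=
  iter n (hadamard f) (1 - fpsX)^-1.

(* Main.v *)
(* A word of length n over the ordered alphabet -1 < 1 < -2 < 2 < ... < -k < k,
   standardized so that equal positive letters increase and equal negative
   letters decrease from left to right, is the same thing as a permutation pi
   together with an enriched pi^-1-partition with parts in the alphabet.  Adding
   the letters one at a time shows that the enriched partitions of a permutation
   sigma of length n are counted by
     sum_k Omega'(sigma; k) t^k = (1/2) ((1+t)/(1-t))^(n+1) u^(pk(sigma)+1),
   so the coefficient of t^k on the left-hand side of (a) enumerates the words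
   over the first 2k letters by length (x) and by occurrences of 12...m (s).
   The occurrences being determined by the consecutive pairs of letters that may
   follow each other in an increasing run, the Goulden-Jackson cluster method
   gives this word series as 1/(1 - f_k), where f_k is the coefficient of t^k in
   the Hadamard base f; and 1/(1 - f_k) is the coefficient of t^k in the sum of
   the Hadamard powers of f.  Part (b) is the case s = 0, and (c) follows from it
   by expanding f_k explicitly. *)
Require Import Defs.
From HB Require Import structures.
From mathcomp Require Import all_boot all_order all_algebra all_fingroup ring zify.
From mathcomp Require Import boolp classical_sets cardinality fsbigop.
Set Implicit Arguments.
Unset Strict Implicit.
Unset Printing Implicit Defensive.
Import GRing.Theory.

(** * Words and runs *)

Fixpoint words (N n : nat) : seq (seq nat) :=
  if n is n'.+1 then [seq a :: w | a <- iota 0 N, w <- words N n'] else [:: [::]].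

Lemma mem_words N n w :
  (w \in words N n) = (size w == n) && all (fun a => a < N) w.
Proof.
elim: n w => [|n IHn] [|a w] //=; first by apply/negbTE/negP => /allpairsP[p []].
rewrite eqSS; apply/allpairsP/idP => [[[b v] /= [bN vn [-> ->]]]|].
  by move: vn bN; rewrite IHn mem_iota => /andP[-> ->] /= ->.
move=> /and3P[sw aN wN]; exists (a, w); split=> //=; last by rewrite IHn sw.
by rewrite mem_iota.
Qed.

Lemma uniq_words N n : uniq (words N n).
Proof.
elim: n => //= n IHn; rewrite allpairs_uniq ?iota_uniq //.
by move=> [a w] [b v] _ _ [-> ->].
Qed.

Lemma sum_words_cat (V : nmodType) N l n (F : seq nat -> V) :
  (\sum_(w <- words N (l + n)) F w =
   \sum_(u <- words N l) \sum_(v <- words N n) F (u ++ v))%R.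
Proof.
elim: l F => [|l IHl] F /=; first by rewrite big_seq1.
by rewrite !big_allpairs_dep; apply: eq_bigr => a _; rewrite IHl.
Qed.

Lemma sum_words1 (V : nmodType) N (F : seq nat -> V) :
  (\sum_(w <- words N 1) F w = \sum_(a < N) F [:: val a])%R.
Proof.
rewrite big_allpairs_dep -(big_mkord xpredT (fun a => F [:: a])) /index_iota subn0.
by apply: eq_bigr => a _; rewrite big_seq1.
Qed.

Section Runs.
Variables (T : Type) (e : rel T).
Implicit Type w : seq T.

(** The relation is left general: it will be [ltn] on permutations, where sorted windows are the
    occurrences of $12\cdots m$, and [enriched_step true] on words. *)
Definition run_occ m w : nat :=
  \sum_(i < (size w).+1 - m) sorted e (take m (drop i w)).

Fixpoint run_length w : nat :=
  if w is a :: w' then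
    if w' is b :: _ then if e a b then (run_length w').+1 else 1 else 1
  else 0.

Lemma run_length_gt0 w : (0 < run_length w) = (0 < size w).
Proof. by case: w => [|a [|b w]] //=; case: ifP. Qed.

Lemma run_length_size w : run_length w <= size w.
Proof.
elim: w => [|a w IHw] //=; case: w IHw => [|b w] //= IHw.
by case: ifP.
Qed.

Lemma sorted_take_run l w : l <= size w -> sorted e (take l w) = (l <= run_length w).
Proof.
elim: w l => [|a w IHw] [|l] //= lw; case: w IHw lw => [|b w] IHw; first by case: l.
case: l => [|l] /= lw; first by case: ifP.
have := IHw l.+1 lw; rewrite [sorted _ _]/= => ->.
by case: (e a b).
Qed.

Lemma run_occ_nil m : 0 < m -> run_occ m [::] = 0.
Proof. by case: m => // m _; rewrite /run_occ big_ord0. Qed.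

Lemma run_occ_cons m a w :
  run_occ m (a :: w) = (m <= run_length (a :: w)) + run_occ m w.
Proof.
have rw := run_length_size (a :: w); rewrite /run_occ.
have [mw | wm] := leqP m (size w).+1.
  rewrite [size _]/= (subSn mw) big_ord_recl drop0 sorted_take_run //.
have -> : (size (a :: w)).+1 - m = 0 by apply/eqP; rewrite subn_eq0.
have -> : (size w).+1 - m = 0 by apply/eqP; rewrite subn_eq0 ltnW.
by rewrite !big_ord0 leqNgt (leq_trans _ wm).
Qed.

(** A window crossing the end of the first maximal run contains a pair where [e] fails, so only
    windows inside what is left of that run, or starting after it, count. Truncated subtraction
    covers a remainder shorter than [m]. *)
Lemma run_occ_drop m l w : 1 < m -> l <= run_length w ->
  run_occ m (drop l w) =
  (run_length w - l).+1 - m + run_occ m (drop (run_length w) w).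
Proof.
move=> m_gt1; elim: w l => [|a w IHw] l lw.
  by case: l lw => // _; rewrite -[LHS]add0n; congr (_ + _) => /=; lia.
have R1 : (run_length (a :: w) == 1) || [&& 0 < run_length w &
    run_length (a :: w) == (run_length w).+1].
  case: w {IHw lw} => [|b w] //; rewrite run_length_gt0 /=.
  by case: (e a b); rewrite eqxx ?orbT.
case: l lw => [|l] lw; last first.
  case/orP: R1 => [/eqP r1|/andP[_ /eqP rS]].
    by rewrite r1 in lw *; rewrite (_ : l = 0) /=; [lia|case: l lw].
  by rewrite rS in lw *; rewrite /= IHw // subSS.
rewrite drop0 run_occ_cons; case/orP: R1 => [/eqP ->|/andP[r0 /eqP ->]].
  by rewrite /= drop0; lia.
by have := IHw 0 isT; rewrite drop0 /= => ->; lia.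
Qed.

End Runs.

(** * Cluster recursion for words weighted by occurrences *)

Section Clusters.
Local Open Scope ring_scope.
Variables (K : comNzRingType) (s : K) (m : nat) (al : nat -> K).
Hypothesis m_gt1 : (1 < m)%N.
Hypothesis cluster_rec : forall p, (0 < p)%N ->
  s ^+ (p.+1 - m) = \sum_(1 <= l < p.+1) al l * s ^+ ((p - l).+1 - m).

(** [cluster_rec] is the case of a single run. The letters after the first run give a common factor
    to the terms with [l] up to the run length, and longer prefixes are not sorted. *)
Lemma run_occ_cluster (T : Type) (e : rel T) (w : seq T) : (0 < size w)%N ->
  s ^+ run_occ e m w =
  \sum_(1 <= l < (size w).+1)
     al l * (sorted e (take l w))%:R * s ^+ run_occ e m (drop l w).
Proof.
move=> w0; set p := run_length e w.
have p0 : (0 < p)%N by rewrite /p run_length_gt0.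
have pw : (p <= size w)%N by apply: run_length_size.
have := run_occ_drop m_gt1 (leq0n p); rewrite drop0 subn0 -/p => ->.
rewrite exprD cluster_rec // mulr_suml [RHS](big_cat_nat _ (n := p.+1)) //=.
rewrite [X in _ + X]big_nat [X in _ + X]big1 ?addr0.
  rewrite big_nat [RHS]big_nat; apply: eq_bigr => l /andP[l0 lp].
  rewrite sorted_take_run; last by lia.
  rewrite (lp : (l <= p)%N) mulr1 (run_occ_drop m_gt1 (lp : (l <= p)%N)) -/p.
  by rewrite exprD mulrA.
move=> l /andP[l0 lw]; rewrite sorted_take_run; last by lia.
by rewrite leqNgt (l0 : (p < l)%N) mulr0 mul0r.
Qed.

(** Cutting words after [l] letters makes the two pieces independent. This is $W=1+fW$ read in
    degree $n>0$. *)
Lemma sum_run_occ_rec (e : rel nat) N n : (0 < n)%N ->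
  \sum_(w <- words N n) s ^+ run_occ e m w =
  \sum_(1 <= l < n.+1) al l * (\sum_(w <- words N l) (sorted e w)%:R)
     * \sum_(w <- words N (n - l)) s ^+ run_occ e m w.
Proof.
move=> n0.
transitivity (\sum_(w <- words N n) \sum_(1 <= l < n.+1)
     al l * (sorted e (take l w))%:R * s ^+ run_occ e m (drop l w)).
  rewrite big_seq [RHS]big_seq; apply: eq_bigr => w.
  by rewrite mem_words => /andP[/eqP wn _]; rewrite run_occ_cluster wn.
rewrite exchange_big /= big_nat [RHS]big_nat; apply: eq_bigr => l /andP[l0 ln].
rewrite -{1}(subnKC (ln : (l <= n)%N)) sum_words_cat -mulrA mulr_suml mulr_sumr.
rewrite big_seq [RHS]big_seq; apply: eq_bigr => u.
rewrite mem_words => /andP[/eqP ul _]; rewrite mulrA mulr_sumr; apply: eq_bigr => v _.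
by rewrite -ul take_size_cat // drop_size_cat.
Qed.

End Clusters.

(** * Enriched words *)

(* The letters -1 < 1 < -2 < 2 < ... of an enriched partition are coded as
   0 < 1 < 2 < 3 < ...: odd letters may repeat along an ascent of the underlying
   permutation, even ones along a descent. *)
Definition enriched_step (d : bool) (a b : nat) : bool :=
  (a < b) || (a == b) && (odd a == d).

(** [d i] tells whether the underlying permutation ascends from position [i] to [i.+1], counted from
    0. *)
Definition enriched (d : nat -> bool) (w : seq nat) : bool :=
  all (fun i => enriched_step (d i) (nth 0 w i) (nth 0 w i.+1))
      (iota 0 (size w).-1).

(* The number of enriched words of length n.+1 ending with a. *)
Fixpoint enriched_ending (d : nat -> bool) (n a : nat) : nat :=
  if n is n'.+1 then
    \sum_(b < a) enriched_ending d n' b + (odd a == d n') * enriched_ending d n' a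
  else 1.

(** A peak is an ascent directly followed by a descent among the first [n] steps of the pattern. *)
Fixpoint peaks (d : nat -> bool) (n : nat) : nat :=
  if n is n'.+1 then peaks d n' + [&& 0 < n', d n'.-1 & ~~ d n'] else 0.

Lemma enriched_rcons d w a : 0 < size w ->
  enriched d (rcons w a) =
  enriched d w && enriched_step (d (size w).-1) (last 0 w) a.
Proof.
case: w => // b w _; rewrite /enriched.
have -> : iota 0 (size (rcons (b :: w) a)).-1 = rcons (iota 0 (size w)) (size w).
  by rewrite size_rcons -[_.+1.-1]/((size w).+1) -addn1 iotaD cats1.
have nthE i : i <= size w -> nth 0 (rcons (b :: w) a) i = nth 0 (b :: w) i.
  by move=> iw; rewrite nth_rcons [size _]/= ltnS iw.
rewrite all_rcons andbC nthE // nth_rcons ltnn eqxx -nth_last; congr (_ && _).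
apply: eq_in_all => i; rewrite mem_iota => /andP[_ iw].
by rewrite !nthE // ltnW.
Qed.

Lemma sum_enriched_step d n N a : a < N ->
  \sum_(b < N) enriched_ending d n b * enriched_step (d n) b a =
  enriched_ending d n.+1 a.
Proof.
move=> aN; rewrite /= -(big_mkord xpredT
  (fun b => enriched_ending d n b * enriched_step (d n) b a)).
rewrite -(big_mkord xpredT (enriched_ending d n)).
rewrite (big_cat_nat _ (ltnW aN)) //=; congr (_ + _).
  rewrite big_nat [RHS]big_nat; apply: eq_bigr => b /= ba.
  by rewrite /enriched_step ba muln1.
rewrite big_ltn // big_nat big1 => [|b /andP[ab _]].
  by rewrite /enriched_step ltnn eqxx mulnC addn0.
by rewrite /enriched_step ltnNge ltnW //= gtn_eqF ?muln0.
Qed.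

(** The weight [F] of the last letter carries the induction: appending a letter replaces [F] by its
    sum over the letters that may follow. *)
Lemma sum_enriched d n N (F : nat -> nat) :
  \sum_(w <- words N n.+1) enriched d w * F (last 0 w) =
  \sum_(a < N) enriched_ending d n a * F a.
Proof.
elim: n F => [|n IHn] F.
  by rewrite sum_words1.
rewrite -addn1 sum_words_cat.
transitivity (\sum_(u <- words N n.+1) enriched d u *
    \sum_(a < N) enriched_step (d n) (last 0 u) a * F a).
  rewrite big_seq [RHS]big_seq; apply: eq_bigr => u.
  rewrite mem_words => /andP[/eqP un _]; rewrite sum_words1 big_distrr /=.
  apply: eq_bigr => a _; rewrite cats1 enriched_rcons ?un // last_rcons.
  by rewrite -mulnb mulnA.
rewrite (IHn (fun b => \sum_(a < N) enriched_step (d n) b a * F a)).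
under eq_bigr do rewrite big_distrr; rewrite exchange_big.
apply: eq_bigr => a _; rewrite -(sum_enriched_step _ _ (ltn_ord a)) big_distrl /=.
by apply: eq_bigr => b _; rewrite mulnA.
Qed.

(** * Standardization *)

Lemma size_one_line n (p : 'S_n) : size (one_line p) = n.
Proof. by rewrite size_map size_enum_ord. Qed.

Lemma nth_map_enum n (T : Type) (x : T) (g : 'I_n -> T) (i : 'I_n) :
  nth x [seq g j | j <- enum 'I_n] i = g i.
Proof. by rewrite (nth_map i) ?size_enum_ord // nth_ord_enum. Qed.

Lemma nth_one_line n (p : 'S_n) (i : 'I_n) : nth 0 (one_line p) i = (p i).+1.
Proof. by rewrite nth_map_enum. Qed.

Lemma uniq_one_line n (p : 'S_n) : uniq (one_line p).
Proof. by rewrite map_inj_uniq ?enum_uniq // => i j [/val_inj/perm_inj]. Qed.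

Lemma one_line1 m : one_line (1%g : 'S_m) = [seq i.+1 | i <- iota 0 m].
Proof.
rewrite -val_enum_ord -map_comp; apply: eq_map => i.
by rewrite /= perm1.
Qed.

(** The ranks of the letters read 0, 1, 2, ... exactly when [v] equals its sorted rearrangement;
    distinctness makes the order strict. *)
Lemma std_eq_id m (v : seq nat) : size v = m -> uniq v ->
  (std v == one_line (1%g : 'S_m)) = sorted ltn v.
Proof.
move=> vm Uv; rewrite one_line1 ltn_sorted_uniq_leq Uv /=.
rewrite /std (map_comp S) (inj_eq (inj_map succn_inj)).
apply/eqP/idP => [idx | vsorted].
  suff <- : sort leq v = v by exact/sort_sorted/leq_total.
  have {2}<- : [seq nth 0 (sort leq v) (index a (sort leq v)) | a <- v] = v.
    by rewrite -[RHS]map_id; apply/eq_in_map => a av; rewrite nth_index ?mem_sort.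
  rewrite (map_comp (nth 0 _) (index^~ _)) idx -vm.
  by rewrite -(size_sort leq) -/(mkseq _ _) mkseq_nth.
rewrite sorted_sort //; last exact: leq_trans.
apply: (@eq_from_nth _ 0) => [|i]; rewrite size_map ?size_iota // => iv.
by rewrite (nth_map 0) // nth_iota -?vm // index_uniq.
Qed.

Lemma occ_id m n (p : 'S_n) : occ (1%g : 'S_m) p = run_occ ltn m (one_line p).
Proof.
rewrite /occ /run_occ size_one_line -sum1dep_card big_mkcond /=.
apply: eq_bigr => i _; rewrite std_eq_id.
- by case: (sorted _ _).
- by rewrite size_takel // size_drop size_one_line; have := ltn_ord i; lia.
- by rewrite take_uniq // drop_uniq // uniq_one_line.
Qed.

Lemma eq_run_occ (T U : Type) (x : T) (y : U) (e : rel T) (f : rel U) m w v :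
  size w = size v ->
  (forall i, i.+1 < size w ->
     e (nth x w i) (nth x w i.+1) = f (nth y v i) (nth y v i.+1)) ->
  run_occ e m w = run_occ f m v.
Proof.
move=> wv ef; rewrite /run_occ -wv; apply: eq_bigr => -[i /= ilt] _.
have sw : size (take m (drop i w)) = m.
  by rewrite size_takel // size_drop; lia.
have sv : size (take m (drop i v)) = m.
  by rewrite size_takel // size_drop; lia.
congr (nat_of_bool _); apply/(sortedP x)/(sortedP y) => H j;
  rewrite ?sw ?sv => jm; move: (H j); rewrite ?sw ?sv => /(_ jm);
  by rewrite !nth_take ?(ltnW jm) // !nth_drop !addnS ef //; lia.
Qed.

Definition ascents (L : seq nat) (i : nat) : bool := nth 0 L i < nth 0 L i.+1.

(** The 1-based position $i$ is a peak when the 0-based step $i-2$ ascends and step $i-1$ does not;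
    letters being distinct, the latter is a descent. *)
Lemma pk_peaks n (p : 'S_n) : pk p = peaks (ascents (one_line p)) n.-1.
Proof.
case: n p => [|n] p; first by [].
rewrite /pk -pred_Sn.
suff H k : k < n.+1 ->
    count (is_peak p) (index_iota 2 k.+1) = peaks (ascents (one_line p)) k.
  exact: H.
elim: k => [|k IHk] kn //; rewrite /= -IHk ?(ltnW kn) //.
case: k kn {IHk} => [|k] kn; first by [].
rewrite /index_iota !subSS !subn0 -[k.+1 in LHS]addn1 iotaD count_cat /= addn0.
congr (_ + _); rewrite /is_peak /letter /ascents !addSn !add0n /=.
congr (nat_of_bool (_ && _)); rewrite -leqNgt ltn_neqAle.
rewrite nth_uniq ?size_one_line ?uniq_one_line //; last exact: ltnW.
by rewrite gtn_eqF.
Qed.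

Section Standardization.
Variables (N n : nat).
Implicit Types (f : {ffun 'I_n -> 'I_N}) (q : 'S_n).

Definition word f : seq nat := [seq val (f i) | i <- enum 'I_n].

Lemma size_word f : size (word f) = n.
Proof. by rewrite size_map size_enum_ord. Qed.

Lemma nth_word f (i : 'I_n) : nth 0 (word f) i = f i.
Proof. by rewrite nth_map_enum. Qed.

Lemma word_inj : injective word.
Proof.
by move=> f g fg; apply/ffunP => i; apply: val_inj; rewrite /= -!nth_word fg.
Qed.

Lemma sum_words_ffun (V : nmodType) (F : seq nat -> V) :
  (\sum_(w <- words N n) F w = \sum_f F (word f))%R.
Proof.
rewrite -[RHS](big_map word xpredT F) /index_enum -enumT; apply: perm_big.
apply: uniq_perm; rewrite ?uniq_words //.
  by rewrite map_inj_uniq ?enum_uniq //; exact: word_inj.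
move=> w; rewrite mem_words; apply/andP/mapP => [[/eqP wn /allP wN]|[f _ ->]].
  have ltw (i : 'I_n) : nth 0 w i < N by apply: wN; rewrite mem_nth // wn.
  exists [ffun i => Ordinal (ltw i)]; rewrite ?mem_enum //.
  apply: (@eq_from_nth _ 0); rewrite ?size_word // wn => i iltn.
  by rewrite -[i]/(val (Ordinal iltn)) nth_word ffunE.
by rewrite size_word eqxx; split=> //; apply/allP => a /mapP[i _ ->]; exact: ltn_ord.
Qed.

(* Sorting the positions of a word by this key is the standardization for which
   equal odd letters increase, and equal even letters decrease, from left to
   right. *)
Definition key f (i : 'I_n) : nat := f i * n + (if odd (f i) then i : nat else n.-1 - i).

(** The offset added to [f i * n] is below [n], so keys compare lexicographically: by letter, then
    by position in the direction given by parity. *)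
Lemma ltn_key f i j :
  (key f i < key f j) =
  (f i < f j) || (f i == f j) && (if odd (f i) then i < j else j < i).
Proof.
have offset k : (if odd (f k) then k : nat else n.-1 - k) < n.
  by have := ltn_ord k; case: (odd _); lia.
rewrite -val_eqE /key /=.
have oi := offset i; have oj := offset j.
have [lt|gt|fij] := ltngtP (f i) (f j).
- by rewrite /=; nia.
- by rewrite /=; apply/negbTE; nia.
move: oi oj; rewrite -fij /= ltn_add2l.
by have := ltn_ord i; have := ltn_ord j; case: (odd _); lia.
Qed.

Lemma key_inj f : injective (key f).
Proof.
move=> i j kij; have := ltn_key f i j; have := ltn_key f j i.
rewrite kij ltnn; case: ltngtP => //= fij.
have {fij} -> : f i = f j by exact: val_inj.
by rewrite eqxx /=; case: (odd _) => a b; apply: val_inj => /=; lia.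
Qed.

(** [q] lists the positions in increasing order of key, so [q^-1] is the standardization of the
    word. *)
Definition sorts_key f q : bool := sorted ltn [seq key f (q i) | i <- enum 'I_n].

Lemma sorts_keyP f q :
  reflect (forall i j : 'I_n, i < j -> key f (q i) < key f (q j)) (sorts_key f q).
Proof.
have sz : size [seq key f (q i) | i <- enum 'I_n] = n.
  by rewrite size_map size_enum_ord.
have nthE (i : 'I_n) : nth 0 [seq key f (q i) | i <- enum 'I_n] i = key f (q i).
  by rewrite nth_map_enum.
apply: (iffP idP) => [srt i j ij | H].
  rewrite -!nthE; apply: (sorted_ltn_nth ltn_trans 0 srt) => //; rewrite inE sz.
    exact: ltn_ord.
  exact: ltn_ord.
apply/(sortedP 0) => i; rewrite sz => iltn.
have := H (Ordinal (ltnW iltn)) (Ordinal iltn) (ltnSn i).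
by rewrite -!nthE.
Qed.

Lemma exists_sorts_key f : exists q, sorts_key f q.
Proof.
pose k := [tuple key f i | i < n].
have /tuple_permP[q kq] : perm_eq (sort leq k) k by rewrite perm_sort.
exists q; rewrite /sorts_key ltn_sorted_uniq_leq map_inj_uniq ?enum_uniq; last first.
  by move=> i j /key_inj/perm_inj.
have -> : [seq key f (q i) | i <- enum 'I_n] = sort leq k.
  by rewrite kq; apply: eq_map => i; rewrite tnth_mktuple.
exact/sort_sorted/leq_total.
Qed.

Lemma sorts_key_uniq f q1 q2 : sorts_key f q1 -> sorts_key f q2 -> q1 = q2.
Proof.
move=> s1 s2; apply/permP => i; apply: (@key_inj f).
suff /(irr_sorted_eq ltn_trans ltnn s1 s2)/eq_in_map -> :
    [seq key f (q1 i) | i <- enum 'I_n] =i [seq key f (q2 i) | i <- enum 'I_n].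
  by [].
  by rewrite mem_enum.
move=> a; apply/mapP/mapP => -[j _ ->].
  by exists (q2^-1 (q1 j))%g; rewrite ?mem_enum // permKV.
by exists (q1^-1 (q2 j))%g; rewrite ?mem_enum // permKV.
Qed.

(** Between adjacent positions [q^-1] ascends exactly when the key does, and for adjacent positions
    that is [enriched_step true]. *)
Lemma sorts_key_occ f q m : sorts_key f q ->
  occ (1%g : 'S_m) (q^-1)%g = run_occ (enriched_step true) m (word f).
Proof.
move=> /sorts_keyP sq; rewrite occ_id.
apply: (@eq_run_occ _ _ 0 0); rewrite size_one_line ?size_word // => i iltn.
pose j := Ordinal (ltnW iltn); pose j' := Ordinal iltn.
rewrite -[i]/(val j) -[(val j).+1]/(val j') !nth_one_line !nth_word.
change (((q^-1)%g j < (q^-1)%g j') = enriched_step true (f j) (f j')).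
have -> : enriched_step true (f j) (f j') = (key f j < key f j').
  have jj' : j < j' := ltnSn i.
  rewrite ltn_key jj' [j' < j]ltnNge (ltnW jj') /enriched_step -val_eqE.
  by case: odd.
have := sq ((q^-1)%g j) ((q^-1)%g j'); have := sq ((q^-1)%g j') ((q^-1)%g j).
rewrite !permKV.
case: (ltngtP ((q^-1)%g j) _) => [_ _ -> //|_ h _|/val_inj/perm_inj jj' _ _].
  by apply/esym/negbTE; rewrite -leqNgt ltnW // h.
by have := congr1 val jj' => /=; lia.
Qed.

(** The word $f\circ q^{-1}$ has letter [f i] at position [q i]. Equal consecutive letters [f i] are
    thus compared through the positions [q i], that is, through the ascents of [q]. *)
Lemma enriched_sorts_key f q :
  enriched (ascents (one_line q)) (word f) =
  sorts_key [ffun i => f ((q^-1)%g i)] q.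
Proof.
have stepE (i i' : 'I_n) : i' = i.+1 :> nat ->
  enriched_step (ascents (one_line q) i) (nth 0 (word f) i) (nth 0 (word f) i.+1)
  = (key [ffun i => f ((q^-1)%g i)] (q i) < key [ffun i => f ((q^-1)%g i)] (q i')).
  move=> ii'; rewrite /ascents -ii' !nth_word !nth_one_line ltn_key !ffunE !permK.
  rewrite /enriched_step ltnS -val_eqE /=; congr (_ || (_ && _)).
  have : q i != q i' by rewrite (inj_eq perm_inj) -val_eqE /= ii'; lia.
  by rewrite -val_eqE /=; case: odd; case: ltngtP.
rewrite /enriched size_word; apply/allP/idP => [H|].
  apply/(sortedP 0) => i; rewrite size_map size_enum_ord => iltn.
  pose j := Ordinal (ltnW iltn); pose j' := Ordinal iltn.
  have := stepE j j' erefl; rewrite H; last by rewrite mem_iota /=; lia.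
  rewrite -[i]/(nat_of_ord j) -[(nat_of_ord j).+1]/(nat_of_ord j').
  by rewrite !nth_map_enum.
move=> /sorts_keyP H i; rewrite mem_iota => /andP[_ ilt].
have iltn : i.+1 < n by lia.
by rewrite (stepE (Ordinal (ltnW iltn)) (Ordinal iltn)) // H.
Qed.

End Standardization.

(** Double count of pairs of a permutation [q] and a word sorted by [q]: for fixed [q] they
    correspond to the enriched words of the ascents of [q], and each word is sorted by exactly one
    [q]. *)
Lemma sum_occ_enriched (K : comNzRingType) (s : K) m N n :
  (\sum_(p : 'S_n.+1) s ^+ occ (1%g : 'S_m) p *
     (\sum_(a < N) enriched_ending (ascents (one_line (p^-1)%g)) n a)%:R =
   \sum_(w <- words N n.+1) s ^+ run_occ (enriched_step true) m w)%R.
Proof.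
rewrite sum_words_ffun (reindex_inj invg_inj) /=.
transitivity (\sum_(q : 'S_n.+1) \sum_(f : {ffun 'I_n.+1 -> 'I_N})
    (s ^+ occ (1%g : 'S_m) (q^-1)%g) *+ sorts_key f q)%R.
  apply: eq_bigr => q _; rewrite invgK.
  have := sum_enriched (ascents (one_line q)) n N (fun=> 1).
  under eq_bigr do rewrite muln1; under [X in _ = X]eq_bigr do rewrite muln1.
  move=> <-; rewrite (sum_words_ffun _ _ (fun w => nat_of_bool (enriched _ w))).
  rewrite natr_sum mulr_sumr.
  rewrite [RHS](reindex (fun f : {ffun 'I_n.+1 -> 'I_N} =>
     [ffun i => f ((q^-1)%g i)])); last first.
    exists (fun f : {ffun 'I_n.+1 -> 'I_N} => [ffun i => f (q i)]) => f _;
      by apply/ffunP => i; rewrite !ffunE (permK, permKV).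
  by apply: eq_bigr => f _; rewrite enriched_sorts_key mulr_natr.
rewrite exchange_big; apply: eq_bigr => f _.
have [q sq] := exists_sorts_key f.
rewrite (bigD1 q) //= sq mulr1n big1 ?addr0 ?(sorts_key_occ _ sq) // => q' q'q.
case: (boolP (sorts_key f q')) => // /sorts_key_uniq/(_ sq) q'E.
by rewrite q'E eqxx in q'q.
Qed.

Local Open Scope ring_scope.

(** * Formal power series *)

Lemma fps_sum_coef (R : comNzRingType) (a N : nat) (F : nat -> fps R) i :
  (forall n, (a <= n)%N -> (N <= n)%N -> F n i = 0) ->
  fps_sum a F i = \sum_(a <= n < N) F n i.
Proof.
move=> F0; rewrite /= (fsbigE (index_iota a N)) ?iota_uniq //.
- rewrite big_seq_cond [RHS]big_seq; apply: eq_bigl => n.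
  by rewrite mem_index_iota; apply: andb_idr => /andP[an _]; apply/mem_set.
- by move=> n /=; rewrite mem_index_iota => /andP[].
- by move=> n /= an; rewrite mem_index_iota an ltnNge /= negbK => /F0 ->.
Qed.

Lemma fps_summable_bound (R : comNzRingType) a (F : nat -> fps R) :
  (forall i, exists N, forall n, (N <= n)%N -> F n i = 0) -> fps_summable a F.
Proof.
move=> F0 i; have [N FN] := F0 i; apply: (sub_finite_set _ (finite_II N)).
move=> n /= [_ Fn]; rewrite ltnNge; apply: contra Fn => /FN ->.
by [].
Qed.

Lemma fps_mulCE (R : comNzRingType) (c : R) (f : fps R) n :
  (fpsC c * f) n = c * f n.
Proof.
rewrite fpsME big_ord_recl big1 => [|i _]; first by rewrite addr0 subn0.
by rewrite mul0r.
Qed.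

Lemma fps_mulXnE (R : comNzRingType) (f : fps R) m n :
  (f * fpsX ^+ m) n = if (m <= n)%N then f (n - m)%N else 0.
Proof.
rewrite mulrC fpsME; under eq_bigr do rewrite fpsXnE.
case: leqP => [mn | nm].
  rewrite (bigD1 (Ordinal (mn : (m < n.+1)%N))) //= eqxx mul1r big1 ?addr0 //.
  by move=> i; rewrite -val_eqE /= => /negbTE ->; rewrite mul0r.
rewrite big1 // => i _; case: eqP => [im|]; last by rewrite mul0r.
by have := ltn_ord i; rewrite im ltnS leqNgt nm.
Qed.

Lemma fps_geom (R : comNzRingType) (g : fps R) : g 0%N = 0 ->
  fps_summable 0 (fun n => g ^+ n) /\ fps_sum 0 (fun n => g ^+ n) * (1 - g) = 1.
Proof.
move=> g0; split.
  by apply: fps_summable_bound => i; exists i.+1 => n; apply: fps_exp_low.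
apply/fpsP => i.
(* Powers beyond [i] vanish up to degree [i], so a finite geometric sum suffices. *)
transitivity (((\sum_(n < i.+1) g ^+ n) * (1 - g)) i).
  rewrite !fpsME; apply: eq_bigr => j _; congr (_ * _).
  rewrite (fps_sum_coef (N := i.+1)) => [|n _ ni].
    by rewrite fps_sumE big_mkord.
  by apply: fps_exp_low => //; apply: leq_trans ni; rewrite ltn_ord.
rewrite mulrC -[1 - g]opprB mulNr -subrX1 opprB.
by rewrite fpsDE fpsNE fps_exp_low // subr0.
Qed.

(** Exchanges the two variables: Hadamard products need $t$ outermost, whereas substituting $z$, a
    multiple of $x$, needs $x$ outermost. *)
Definition fps_swap (R : Type) (F : fps (fps R)) : fps (fps R) :=
  Fps (fun k => Fps (fun i => F i k)).

Lemma fps_swapE (R : Type) (F : fps (fps R)) k i : fps_swap F k i = F i k.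
Proof. by []. Qed.

Section SwapMorphism.
Variable R : comNzRingType.

Fact fps_swap_is_zmod_morphism : zmod_morphism (@fps_swap R).
Proof. by move=> F G; apply/fpsP => k; apply/fpsP => i. Qed.
HB.instance Definition _ := GRing.isZmodMorphism.Build (fps (fps R)) (fps (fps R))
  (@fps_swap R) fps_swap_is_zmod_morphism.

Fact fps_swap_is_monoid_morphism : monoid_morphism (@fps_swap R).
Proof.
split=> [|F G]; apply/fpsP => k; apply/fpsP => i.
  by case: i k => [|i] [|k].
change ((F * G) i k = (fps_swap F * fps_swap G) k i).
rewrite !fpsME !fps_sumE.
under eq_bigr do rewrite fpsME; under [RHS]eq_bigr do rewrite fpsME.
by rewrite exchange_big.
Qed.
HB.instance Definition _ := GRing.isMonoidMorphism.Build (fps (fps R))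
  (fps (fps R)) (@fps_swap R) fps_swap_is_monoid_morphism.

Lemma fps_swapX : fps_swap fpsX = fpsC fpsX :> fps (fps R).
Proof. by apply/fpsP => k; apply/fpsP => i /=; case: k i => [|k] [|[|i]]. Qed.

Lemma fps_swapCX : fps_swap (fpsC fpsX) = fpsX :> fps (fps R).
Proof. by apply/fpsP => k; apply/fpsP => i /=; case: k i => [|[|k]] [|i]. Qed.

Lemma fps_swapCC (c : R) : fps_swap (fpsC (fpsC c)) = fpsC (fpsC c).
Proof. by apply/fpsP => k; apply/fpsP => i /=; case: k i => [|k] [|i]. Qed.

End SwapMorphism.

(* The substitution X |-> b X. *)
Definition fps_dilate (R : comNzRingType) (b : fps R) (a : fps R) : fps (fps R) :=
  Fps (fun i => fpsC (a i) * b ^+ i).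

Section DilateMorphism.
Variables (R : comNzRingType) (b : fps R).

Fact fps_dilate_is_zmod_morphism : zmod_morphism (fps_dilate b).
Proof. by move=> f g; apply/fpsP => i; rewrite /= rmorphB mulrBl. Qed.
HB.instance Definition _ := GRing.isZmodMorphism.Build (fps R) (fps (fps R))
  (fps_dilate b) fps_dilate_is_zmod_morphism.

Fact fps_dilate_is_monoid_morphism : monoid_morphism (fps_dilate b).
Proof.
split=> [|f g]; apply/fpsP => i.
  by case: i => [|i] /=; rewrite ?rmorph1 ?mulr1 // rmorph0 mul0r.
rewrite [LHS]/= fpsME rmorph_sum mulr_suml; apply: eq_bigr => j _ /=.
have lej : (j <= i)%N by rewrite -ltnS ltn_ord.
by rewrite [RHS]mulrACA -exprD subnKC // rmorphM.
Qed.
HB.instance Definition _ := GRing.isMonoidMorphism.Build (fps R)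
  (fps (fps R)) (fps_dilate b) fps_dilate_is_monoid_morphism.

Lemma fps_dilateX : fps_dilate b fpsX = fpsC b * fpsX.
Proof.
apply/fpsP => i; rewrite fps_mulCE /=.
by case: i => [|[|i]]; rewrite ?rmorph0 ?rmorph1 ?mul0r ?mulr0 ?mulr1 ?mul1r.
Qed.

Lemma fps_dilateC (c : R) : fps_dilate b (fpsC c) = fpsC (fpsC c).
Proof. by apply/fpsP => -[|i] /=; rewrite ?mulr1 // rmorph0 mul0r. Qed.

End DilateMorphism.

(** * Enriched order polynomials *)

Section OrderPolynomial.
Local Open Scope ring_scope.
Variable B : comUnitRingType.
Hypothesis unit2 : (2 : B) \is a GRing.unit.
Local Notation t := (fpsX : fps B).
Implicit Type d : nat -> bool.

Lemma unit_fps2 : (2 : fps B) \is a GRing.unit.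
Proof. by rewrite fps_unitE. Qed.

Lemma unit_1Bt : (1 - t) \is a GRing.unit.
Proof. by rewrite fps_unitE fpsDE fpsNE /= subr0 unitr1. Qed.

Lemma unit_1Dt : (1 + t) \is a GRing.unit.
Proof. by rewrite fps_unitE fpsDE /= addr0 unitr1. Qed.

Lemma fps_mulXE (f : fps B) n : (t * f) n.+1 = f n.
Proof. by rewrite mulrC -[t]expr1 fps_mulXnE subn1. Qed.

Lemma fps_mulX0 (f : fps B) : (t * f) 0%N = 0.
Proof. by rewrite mulrC -[t]expr1 fps_mulXnE. Qed.

Definition enriched_gf d n : fps B :=
  Fps (fun k => (\sum_(a < k.*2) enriched_ending d n a)%:R).

(** The letter $-k$ has code $2(k-1)$, so the words counted here end with $-k$. *)
Definition enriched_neg_gf d n : fps B :=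
  Fps (fun k => if k is k'.+1 then (enriched_ending d n k'.*2)%:R else 0).

Lemma enriched_gf0 d : (1 - t) * enriched_gf d 0 = 2 * enriched_neg_gf d 0.
Proof.
apply/fpsP => k; rewrite mulrBl mul1r mulr_natl mulr2n fpsDE fpsNE [RHS]fpsDE.
case: k => [|k]; rewrite ?fps_mulX0 ?fps_mulXE /= ?big_ord0 ?subr0 ?addr0 //.
rewrite !big_ord_recr /= !natrD; ring.
Qed.

Lemma enriched_neg_gf0 d : (1 - t) * enriched_neg_gf d 0 = t.
Proof.
apply/fpsP => k; rewrite mulrBl mul1r fpsDE fpsNE.
case: k => [|[|k]]; rewrite ?fps_mulX0 ?fps_mulXE /= ?subr0 ?subrr //.
Qed.

Lemma enriched_neg_gfS d n :
  enriched_neg_gf d n.+1 =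
  t * enriched_gf d n + (if d n then 0 else enriched_neg_gf d n).
Proof.
apply/fpsP => k; rewrite fpsDE; case: k => [|k].
  by rewrite fps_mulX0 add0r; case: (d n).
rewrite fps_mulXE /= natrD odd_double; case: (d n); first by rewrite mul0n.
by rewrite mul1n.
Qed.

(** The factor $1-t$ leaves, in degree $k$, the words ending with $-k$ or $k$. At an ascent only $k$
    may repeat the preceding letter, at a descent only $-k$. *)
Lemma enriched_gfS d n :
  (1 - t) * enriched_gf d n.+1 =
  if d n then (1 + t) * enriched_gf d n
  else 2 * (t * enriched_gf d n + enriched_neg_gf d n).
Proof.
apply/fpsP => k; rewrite mulrBl mulrDl mul1r mul1r mulr_natl mulr2n.
case: k => [|k].
  rewrite fpsDE fpsNE fps_mulX0.
  by case: (d n); rewrite !fpsDE fps_mulX0 /= !big_ord0 ?subr0 ?addr0.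
rewrite fpsDE fpsNE fps_mulXE; case dn: (d n); rewrite !fpsDE !fps_mulXE /=;
  rewrite !big_ord_recr /= dn odd_double /= ?mul0n ?mul1n ?addn0 !natrD; ring.
Qed.

(** Each further letter multiplies the series by $(1+t)/(1-t)$, and a descent right after an ascent
    brings the extra factor $4t/(1+t)^2$. *)
Lemma enriched_gfE d n :
  enriched_gf d n =
  2^-1 * ((1 + t) / (1 - t)) ^+ n.+2 * (4 * t / (1 + t) ^+ 2) ^+ (peaks d n).+1.
Proof.
have i1 := divrr unit_1Bt; have j1 := divrr unit_1Dt; have h1 := divrr unit_fps2.
rewrite -exprVn; set i := (1 - t)^-1 in i1 *.
set j := (1 + t)^-1 in j1 *; set h := 2^-1 in h1 *.
pose T := enriched_gf d; pose E := enriched_neg_gf d.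
(* A descent involves both [T n] and [E n], so the induction also carries their relation, which
   depends on whether the last step ascended. *)
suff [] : T n = h * ((1 + t) * i) ^+ n.+2 * (4 * t * j ^+ 2) ^+ (peaks d n).+1
  /\ (if (0 < n)%N && d n.-1 then (1 + t) * E n = t * (1 - t) * T n
      else 2 * E n = (1 - t) * T n) by [].
elim: n => [|n [IHT IHE]].
  split; last by rewrite -enriched_gf0.
  have -> : T 0%N = i * ((1 - t) * T 0%N) by rewrite mulrA [i * _]mulrC i1 mul1r.
  rewrite enriched_gf0 -/(E 0%N).
  have -> : E 0%N = i * ((1 - t) * E 0%N) by rewrite mulrA [i * _]mulrC i1 mul1r.
  rewrite enriched_neg_gf0 expr1.
  transitivity (2 * h * 2 * t * i ^+ 2 * ((1 + t) * j) ^+ 2); last by ring.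
  by rewrite h1 j1; ring.
have TS : T n.+1 = i * ((1 - t) * T n.+1) by rewrite mulrA [i * _]mulrC i1 mul1r.
have ES := enriched_neg_gfS d n; rewrite -/(T n) -/(E n.+1) -/(E n) in ES.
have := enriched_gfS d n; rewrite -/(T n) -/(T n.+1) -/(E n) => TSE.
rewrite [peaks d n.+1]/= [n.+1.-1]/= ltn0Sn andTb.
case dn: (d n) in TSE ES *.
  rewrite !andbF addn0; split; last by rewrite -mulrA TSE ES; ring.
  by rewrite TS TSE IHT [in RHS]exprS; ring.
have EE : 2 * E n.+1 = (1 - t) * T n.+1 by rewrite TSE ES.
split=> //; case: ifP IHE => dn' IHE; rewrite ?andbT dn' ?addn1 ?addn0 TS TSE.
  have -> : t * T n + E n = j * (2 * t * T n).
    transitivity (((1 + t) * j) * (t * T n + E n)); first by rewrite j1 mul1r.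
    transitivity (j * ((1 + t) * t * T n + (1 + t) * E n)); first by ring.
    by rewrite IHE; ring.
  rewrite IHT [in RHS]exprS [in RHS](exprS _ (peaks d n).+1).
  set P := (_ ^+ n.+2); set Q := (_ ^+ (peaks d n).+1).
  transitivity (h * P * Q * (4 * t) * i * j * ((1 + t) * j)); last by ring.
  by rewrite j1; ring.
rewrite mulrDr IHE IHT [in RHS]exprS; ring.
Qed.

End OrderPolynomial.

(** * The cluster method *)

Lemma geom_sum_nat (R : comNzRingType) (y : R) m : (0 < m)%N ->
  (1 - y) * \sum_(1 <= l < m) y ^+ l = y - y ^+ m.
Proof.
move=> m0; rewrite mulr_sumr (telescope_sumr_eq (fun l => - y ^+ l)) //.
  by rewrite opprK expr1 addrC.
by move=> l _; rewrite exprS; ring.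
Qed.

(** Isolates the factor $2t/(1-t^2)$ of the Hadamard base; what remains is the cluster series
    evaluated at $z$. *)
Lemma cluster_series_factor (A : comUnitRingType) (t x r zm y : A) :
  1 - t \is a GRing.unit -> 1 + t \is a GRing.unit -> y \is a GRing.unit ->
  2 * t * x / (1 - t) ^+ 2 + 2 * t * r * zm / ((1 - t ^+ 2) * y) =
  2 * t / (1 - t ^+ 2) * ((1 + t) * x / (1 - t) + r * zm / y).
Proof.
move=> Ui Uj Uy; have j1 := mulVr Uj.
have -> : 1 - t ^+ 2 = (1 - t) * (1 + t) by ring.
rewrite !invrM ?unitrM ?Ui ?Uj //.
set i := (1 - t)^-1; set j := (1 + t)^-1 in j1 *; set v := y^-1.
transitivity (2 * t * x * i * i * (j * (1 + t)) + 2 * t * r * zm * (v * (j * i))).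
  by rewrite j1; ring.
by ring.
Qed.

Section Cluster.
Variables (K : comUnitRingType) (s : K) (m : nat).
Hypothesis m_gt1 : (1 < m)%N.
Local Notation X := (fpsX : fps K).
Local Notation r := (fpsC (s - 1) : fps K).
Local Notation G := (\sum_(1 <= l < m) X ^+ l).

(* The generating function of clusters of occurrences of 12...m, an occurrence
   inside a cluster having weight s - 1. *)
Definition cluster_gf : fps K := X + r * X ^+ m / (1 - r * G).

Lemma coef_sumX n : G n = (0 < n < m)%:R.
Proof.
rewrite fps_sumE; under eq_bigr do rewrite fpsXnE.
have [nm | nm] := boolP (0 < n < m)%N.
  rewrite (bigD1_seq n) /= ?iota_uniq ?mem_index_iota // eqxx big1 ?addr0 //.
  by move=> i; rewrite eq_sym => /negbTE ->.
rewrite big_nat big1 // => i im; case: eqP => // ni.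
by rewrite ni im in nm.
Qed.

Lemma unit_1B_mul_sum (c : fps K) : 1 - c * G \is a GRing.unit.
Proof.
by rewrite fps_unitE fpsDE fpsNE fpsME big_ord1 coef_sumX mulr0 subr0 unitr1.
Qed.

Lemma cluster_gf_rmorph (A : comUnitRingType) (phi : {rmorphism fps K -> A}) :
  1 - phi r * \sum_(1 <= l < m) phi X ^+ l \is a GRing.unit /\
  phi cluster_gf =
    phi X + phi r * phi X ^+ m / (1 - phi r * \sum_(1 <= l < m) phi X ^+ l).
Proof.
rewrite /cluster_gf; move: (fpsC (s - 1)) => c; have Uc := unit_1B_mul_sum c.
have phiE : phi (1 - c * G) = 1 - phi c * \sum_(1 <= l < m) phi X ^+ l.
  rewrite rmorphB rmorph1 rmorphM rmorph_sum.
  by under eq_bigr do rewrite rmorphXn.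
rewrite -phiE rmorph_unit //; split=> //.
by rewrite rmorphD !rmorphM rmorphV // rmorphXn.
Qed.

Lemma cluster_gf0 : cluster_gf 0%N = 0.
Proof.
rewrite /cluster_gf fpsDE mulrAC fps_mulXnE leqn0 gtn_eqF ?(ltnW m_gt1) //.
exact: addr0.
Qed.

(** A run has weight 1 below length [m] and gains a factor [s] per letter from length [m] on, so its
    series is $(1-(s-1)G)/(1-sX)$, the inverse of 1 minus the cluster series. *)
Lemma cluster_gf_run :
  Fps (fun p => s ^+ (p.+1 - m)) * (1 - cluster_gf) = 1.
Proof.
set A := Fps _.
have AX : A * (1 - fpsC s * X) = 1 - r * G.
  apply/fpsP => p; rewrite mulrBr mulr1 mulrCA !fpsDE !fpsNE !fps_mulCE.
  rewrite coef_sumX fps1E -[X]expr1 fps_mulXnE.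
  case: p => [|p]; first by rewrite /= !mulr0 (_ : 1 - m = 0)%N //; lia.
  rewrite subn1 /=; case: ltnP => pm.
    have [-> ->] : (p.+2 - m = 0 /\ p.+1 - m = 0)%N by lia.
    by rewrite sub0r !mulr1 opprB.
  by rewrite (subSn pm) exprS subrr mulr0 subr0.
have GX := geom_sum_nat X (ltnW m_gt1).
have cl : (1 - cluster_gf) * (1 - r * G) = 1 - fpsC s * X.
  rewrite /cluster_gf opprD addrA mulrDl mulNr divrK ?unit_1B_mul_sum //.
  have -> : fpsC s = r + 1 by rewrite rmorphB subrK.
  transitivity (1 - X - r * ((1 - X) * G) - r * X ^+ m); first by ring.
  by rewrite GX; ring.
apply: (mulIr (unit_1B_mul_sum r)).
by rewrite -mulrA cl AX mul1r.
Qed.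

Lemma cluster_gf_rec p : (0 < p)%N ->
  s ^+ (p.+1 - m) =
  \sum_(1 <= l < p.+1) cluster_gf l * s ^+ ((p - l).+1 - m).
Proof.
move=> p0; have := cluster_gf_run; set A := Fps _.
rewrite mulrBr mulr1 => /(canRL (subrK _)) /fpsP/(_ p).
rewrite [LHS]/= fpsDE fps1E gtn_eqF // add0r mulrC fpsME => ->.
by rewrite big_ord_recl cluster_gf0 mul0r add0r big_add1 big_mkord.
Qed.

End Cluster.

(** * Comparison of both sides coefficientwise in $t$ *)

Section PeakSeries.
Variables (K : comUnitRingType) (s : K) (m : nat).
Hypotheses (unit2 : (2 : K) \is a GRing.unit) (m_gt1 : (1 < m)%N).
Local Notation t0 := (fpsX : fps K).
Local Notation Z := ((1 + t0) / (1 - t0)).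
Local Notation u0 := (4 * t0 / (1 + t0) ^+ 2).
Local Notation C := (2 * t0 / (1 - t0 ^+ 2)).

Lemma sorted_enriched (w : seq nat) :
  sorted (enriched_step true) w = enriched (fun=> true) w.
Proof.
apply/(sortedP 0)/allP => H i.
  by move: (H i); rewrite mem_iota add0n; case: (size w) => [|k] h // /h.
by move=> ilt; apply: H; rewrite mem_iota; case: (size w) ilt.
Qed.

Lemma peaks_ascending n : peaks (fun=> true) n = 0%N.
Proof. by elim: n => //= n ->; rewrite !andbF. Qed.

Lemma unit_1Bt2 : 1 - t0 ^+ 2 \is a GRing.unit.
Proof.
have -> : 1 - t0 ^+ 2 = (1 - t0) * (1 + t0) by ring.
by rewrite unitrM unit_1Bt unit_1Dt.
Qed.

(** Sorted words are the enriched words of the all-ascending pattern, which has no peaks. *)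
Lemma sorted_words_coef k l : (0 < l)%N ->
  \sum_(w <- words k.*2 l) (sorted (enriched_step true) w)%:R = (C * Z ^+ l) k.
Proof.
case: l => // l _.
have -> : C * Z ^+ l.+1 = enriched_gf K (fun=> true) l.
  rewrite enriched_gfE // peaks_ascending expr1 [in RHS]exprS.
  have h1 := mulVr (unit_fps2 unit2).
  have i1 := mulVr (unit_1Bt K); have j1 := mulVr (unit_1Dt K).
  have -> : 1 - t0 ^+ 2 = (1 - t0) * (1 + t0) by ring.
  rewrite invrM ?unit_1Bt ?unit_1Dt // -exprVn.
  set i := (1 - t0)^-1 in i1 *; set j := (1 + t0)^-1 in j1 *.
  set h := 2^-1 in h1 *.
  transitivity (2 * t0 * i * (h * 2) * (j * (1 + t0)) * j * ((1 + t0) * i) ^+ l.+1);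
    last by ring.
  by rewrite h1 j1; ring.
have := sum_enriched (fun=> true) l k.*2 (fun=> 1%N).
under eq_bigr do rewrite muln1; under [X in _ = X]eq_bigr do rewrite muln1.
rewrite /enriched_gf /= => <-; rewrite natr_sum.
by apply: eq_bigr => w _; rewrite sorted_enriched.
Qed.

Definition words_gf k : fps K :=
  Fps (fun n => \sum_(w <- words k.*2 n) s ^+ run_occ (enriched_step true) m w).

(** The coefficient of $t^k$ in the Hadamard base: clusters of [l] letters, times the number of
    sorted words of length [l] over [k.*2] letters. *)
Definition cluster_coef k : fps K :=
  Fps (fun l => cluster_gf s m l * (C * Z ^+ l) k).

Lemma cluster_coef0 k : cluster_coef k 0%N = 0.
Proof.
by rewrite -[LHS]/(cluster_gf s m 0%N * (_ : fps K) k) cluster_gf0 // mul0r.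
Qed.

Lemma words_gfE k : words_gf k * (1 - cluster_coef k) = 1.
Proof.
rewrite mulrBr mulr1; apply/(canLR (addrK _)); rewrite mulrC.
apply/fpsP => n; rewrite fpsDE fpsME fps1E; case: n => [|n].
  rewrite big_ord1 cluster_coef0 mul0r addr0 [LHS]/= big_seq1.
  by rewrite run_occ_nil // ltnW.
rewrite big_ord_recl cluster_coef0 mul0r !add0r.
rewrite [LHS](sum_run_occ_rec m_gt1 (cluster_gf_rec s m_gt1)) //.
rewrite big_add1 big_mkord; apply: eq_bigr => l _.
by rewrite sorted_words_coef.
Qed.

(** The coefficient of $x^n$ in $P_{12\cdots m,n}^{\mathrm{ipk}}(s,u)z^n$, as a series in $t$. *)
Definition perm_gf n : fps K := P_ipk (1%g : 'S_m) n (fpsC s) u0 * Z ^+ n.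

(** The double count attaches to [p] the enriched words of the ascents of [p^-1], and their series
    depends only on the peaks of [p^-1], which number [ipk p]. *)
Lemma words_gf_perm n k :
  words_gf k n.+1 = ((1 + t0) / (2 * (1 - t0)) * perm_gf n.+1) k.
Proof.
rewrite [LHS]/= -sum_occ_enriched /perm_gf mulr_suml mulr_sumr fps_sumE.
apply: eq_bigr => p _; rewrite -rmorphXn -(mulrA (fpsC _)).
rewrite (mulrCA _ (fpsC _)) fps_mulCE.
congr (_ * _).
rewrite -[RHS]/((_ : fps K) k) -[LHS]/(enriched_gf K _ n k) enriched_gfE //.
rewrite -[n in peaks _ n]/(n.+1.-1) -pk_peaks -/(ipk p).
congr (fps_coef _ k).
rewrite (invrM (unit_fps2 unit2) (unit_1Bt K)) [in LHS]exprS; ring.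
Qed.

Local Notation t := (fpsX : fps (fps K)).
Local Notation x := (fpsC fpsX : fps (fps K)).
Local Notation s' := (fpsC (fpsC s) : fps (fps K)).
Local Notation u := (4 * t / (1 + t) ^+ 2).
Local Notation z := ((1 + t) * x / (1 - t)).

Lemma swap_1Bt : fps_swap (fpsC (1 - t0)) = 1 - t.
Proof. by rewrite !rmorphB !rmorph1 /= fps_swapCX. Qed.

Lemma swap_1Dt : fps_swap (fpsC (1 + t0)) = 1 + t.
Proof. by rewrite !rmorphD !rmorph1 /= fps_swapCX. Qed.

Lemma swap_u : fps_swap (fpsC u0) = u.
Proof.
rewrite !rmorphM !rmorphV ?unitrX ?unit_1Dt //; last first.
  by rewrite rmorph_unit // unitrX ?unit_1Dt.
by rewrite !rmorphXn /= swap_1Dt fps_swapCX !rmorph_nat.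
Qed.

Lemma swap_z : fps_swap (fpsC Z * fpsX) = z.
Proof.
rewrite !rmorphM !rmorphV ?unit_1Bt ?rmorph_unit ?unit_1Bt //.
by rewrite /= swap_1Dt swap_1Bt fps_swapX mulrAC.
Qed.

Lemma unit_1Bzm : 1 - z ^+ m \is a GRing.unit.
Proof.
rewrite -swap_z (_ : 1 - _ = fps_swap (1 - (fpsC Z * fpsX) ^+ m)); last first.
  by rewrite rmorphB rmorph1 rmorphXn.
rewrite rmorph_unit // fps_unitE fpsDE fpsNE fps_exp_low ?subr0 ?unitr1 //.
  by rewrite fps_mulCE mulr0.
exact: ltnW.
Qed.

Lemma P_ipk_rmorph (A1 A2 : comNzRingType) (phi : {rmorphism A1 -> A2})
    n (sg : 'S_m) a b :
  P_ipk sg n (phi a) (phi b) = phi (P_ipk sg n a b).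
Proof.
rewrite /P_ipk rmorph_sum; apply: eq_bigr => p _.
by rewrite rmorphM !rmorphXn.
Qed.

Lemma Pz_swap n :
  P_ipk (1%g : 'S_m) n s' u * z ^+ n = fps_swap (fpsC (perm_gf n) * fpsX ^+ n).
Proof.
rewrite -swap_u -(fps_swapCC s) -swap_z /perm_gf.
rewrite !P_ipk_rmorph -rmorphXn -rmorphM exprMn mulrA.
by rewrite -rmorphXn -rmorphM.
Qed.

Lemma coef_Pz n k i :
  (P_ipk (1%g : 'S_m) n s' u * z ^+ n) k i = if i == n then perm_gf n k else 0.
Proof.
rewrite Pz_swap fps_swapE fps_mulCE fpsXnE.
by case: eqP => _; rewrite ?mulr1 ?mulr0 ?fps0E.
Qed.

Lemma Pz_summable :
  fps_summable2 1 (fun n => P_ipk (1%g : 'S_m) n s' u * z ^+ n).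
Proof.
move=> k; apply: fps_summable_bound => i; exists i.+1 => n ni.
by rewrite coef_Pz ltn_eqF.
Qed.

Lemma Pz_sum :
  fps_sum2 1 (fun n => P_ipk (1%g : 'S_m) n s' u * z ^+ n) =
  fps_swap (Fps (fun i => if i is i'.+1 then perm_gf i else 0)).
Proof.
apply/fpsP => k; apply/fpsP => i.
rewrite [LHS](fps_sum_coef (N := i.+1)) => [|n _ ni]; last first.
  by rewrite coef_Pz ltn_eqF.
under eq_bigr do rewrite coef_Pz eq_sym.
case: i => [|i] /=; first by rewrite big_geq // if_same.
rewrite big_nat_recr //= eqxx big_nat big1 ?add0r // => j /andP[_ ji].
by rewrite ltn_eqF.
Qed.

Lemma fps_inv1Bt k : ((1 - t)^-1) k = 1.
Proof.
have -> : (1 - t)^-1 = Fps (fun=> 1); last by [].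
apply: (mulIr (unit_1Bt (fps K))); rewrite mulVr ?unit_1Bt //.
apply/fpsP => -[|n]; rewrite mulrBr mulr1 fpsDE fpsNE [_ * t]mulrC.
  by rewrite fps_mulX0 subr0.
by rewrite fps_mulXE subrr.
Qed.

Lemma lhs_coef k :
  (1 / (1 - t) + (1 + t) / (2 * (1 - t)) *
     fps_sum2 1 (fun n => P_ipk (1%g : 'S_m) n s' u * z ^+ n)) k = words_gf k.
Proof.
have -> : (1 + t) / (2 * (1 - t)) = fps_swap (fpsC ((1 + t0) / (2 * (1 - t0)))).
  have U : 2 * (1 - t0) \is a GRing.unit by rewrite unitrM unit_1Bt unit_fps2.
  by rewrite !rmorphM !rmorphV ?rmorph_unit // !rmorphM !rmorph_nat /= swap_1Bt swap_1Dt.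
rewrite Pz_sum -rmorphM div1r fpsDE fps_inv1Bt; apply/fpsP => n.
rewrite fpsDE fps1E fps_swapE fps_mulCE.
case: n => [|n]; last by rewrite add0r words_gf_perm.
rewrite -[fps_coef (Fps _) 0%N]/(0 : fps K) mulr0 fps0E addr0 [RHS]/= big_seq1.
by rewrite run_occ_nil // ltnW.
Qed.

Lemma hadamard_expE (f : fps (fps K)) n k : hadamard_exp f n k = (f k) ^+ n.
Proof.
by elim: n => [|n IHn] /=; rewrite ?fps_inv1Bt // -/(hadamard_exp f n) IHn exprS.
Qed.

Definition cluster_series : fps (fps K) :=
  2 * t * x / (1 - t) ^+ 2
  + 2 * t * (s' - 1) * z ^+ m
    / ((1 - t ^+ 2) * (1 - (s' - 1) * \sum_(1 <= l < m) z ^+ l)).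

(** The Hadamard base comes from the cluster series by substituting $Zx$ for $X$, multiplying by [C]
    and exchanging the variables. *)
Lemma coef_cluster_series k : cluster_series k = cluster_coef k.
Proof.
suff -> : cluster_series = fps_swap (fpsC C * fps_dilate Z (cluster_gf s m)).
  apply/fpsP => l; rewrite fps_swapE fps_mulCE.
  rewrite -[fps_dilate _ _ l]/(fpsC (cluster_gf s m l) * Z ^+ l).
  by rewrite mulrCA fps_mulCE.
rewrite rmorphM.
have := cluster_gf_rmorph s m (@fps_swap K \o fps_dilate Z).
rewrite /= fps_dilateX fps_dilateC swap_z fps_swapCC !rmorphB !rmorph1.
case=> Uz ->.
have -> : fps_swap (fpsC C) = 2 * t / (1 - t ^+ 2).
  rewrite !rmorphM !rmorphV ?rmorph_unit ?unit_1Bt2 //.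
  by rewrite !rmorphB !rmorph1 !rmorphXn !rmorph_nat /= fps_swapCX.
apply: cluster_series_factor; [exact: unit_1Bt | exact: unit_1Dt | exact: Uz].
Qed.

Lemma peak_series :
  [/\ fps_summable2 1 (fun n => P_ipk (1%g : 'S_m) n s' u * z ^+ n),
      fps_summable2 0 (hadamard_exp cluster_series)
    & 1 / (1 - t) + (1 + t) / (2 * (1 - t)) *
        fps_sum2 1 (fun n => P_ipk (1%g : 'S_m) n s' u * z ^+ n)
      = fps_sum2 0 (hadamard_exp cluster_series)].
Proof.
have hE k : (fun n => hadamard_exp cluster_series n k) = GRing.exp (cluster_coef k).
  apply/boolp.funext => n.
  by rewrite hadamard_expE coef_cluster_series.
split; first exact: Pz_summable.
  by move=> k; rewrite hE; have [] := fps_geom (cluster_coef0 k).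
apply/fpsP => k; rewrite lhs_coef /fps_sum2 [RHS]/= hE.
have [_ sum1] := fps_geom (cluster_coef0 k).
(* Both coefficients are inverse to [1 - cluster_coef k]. *)
apply: (@mulIr _ (1 - cluster_coef k)); last by rewrite words_gfE sum1.
by apply/unitrPr; exists (words_gf k); rewrite mulrC words_gfE.
Qed.

End PeakSeries.

(** * Explicit coefficients *)

Lemma fps_inv1BX_exp (K : comUnitRingType) n :
  (1 - fpsX)^-1 ^+ n.+1 = Fps (fun l => 'C(l + n, l)%:R) :> fps K.
Proof.
have U := unit_1Bt K; elim: n => [|n IHn].
  apply: (mulIr U); rewrite expr1 mulVr //; apply/fpsP => -[|l];
    rewrite mulrBr mulr1 fpsDE fpsNE mulrC ?fps_mulX0 ?fps_mulXE /=.
    by rewrite subr0.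
  by rewrite !addn0 !binn subrr.
apply: (mulIr U); rewrite exprSr mulrVK // IHn; apply/fpsP => -[|l];
  rewrite mulrBr mulr1 fpsDE fpsNE mulrC ?fps_mulX0 ?fps_mulXE /=.
  by rewrite subr0 !bin0.
by rewrite (addSn l n.+1) (binS (l + n.+1)) natrD addrK addSnnS.
Qed.

Lemma fps_1DX_exp (K : comUnitRingType) n :
  (1 + fpsX) ^+ n = Fps (fun l => 'C(n, l)%:R) :> fps K.
Proof.
elim: n => [|n IHn]; first by apply/fpsP => -[|l].
rewrite exprS IHn; apply/fpsP => -[|l];
  rewrite mulrDl mul1r fpsDE ?fps_mulX0 ?fps_mulXE /=.
  by rewrite addr0 !bin0.
by rewrite binS natrD.
Qed.

Section Explicit.
Variable K : comUnitRingType.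
Hypothesis unit2 : (2 : K) \is a GRing.unit.
Local Notation t0 := (fpsX : fps K).

(** One factor $1+t$ cancels, leaving $2t(1+t)^{i-1}/(1-t)^{i+1}$, a convolution of binomials; the
    factor $t$ turns [l] into [l - 1]. *)
Lemma chain_coef i k : (0 < i)%N ->
  (2 * t0 / (1 - t0 ^+ 2) * ((1 + t0) / (1 - t0)) ^+ i) k =
  (2 * \sum_(1 <= l < k.+1) 'C(l + i - 1, l - 1) * 'C(i - 1, k - l))%:R.
Proof.
case: i => // i _.
have -> : 2 * t0 / (1 - t0 ^+ 2) * ((1 + t0) / (1 - t0)) ^+ i.+1 =
    t0 * (2%:R * ((1 - t0)^-1 ^+ i.+2 * (1 + t0) ^+ i)).
  have j1 := mulVr (unit_1Dt K).
  have -> : 1 - t0 ^+ 2 = (1 - t0) * (1 + t0) by ring.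
  rewrite invrM ?unit_1Bt ?unit_1Dt //.
  set b := (1 - t0)^-1; set j := (1 + t0)^-1 in j1 *.
  rewrite exprMn (exprS _ i) (exprS b i.+1).
  transitivity (2 * t0 * b * b ^+ i.+1 * (1 + t0) ^+ i * (j * (1 + t0))); first by ring.
  by rewrite j1; ring.
rewrite fps_inv1BX_exp fps_1DX_exp natrM; case: k => [|k].
  by rewrite fps_mulX0 big_geq // mulr0.
rewrite fps_mulXE -(rmorph_nat (@fpsC K)) fps_mulCE fpsME; congr (_ * _).
rewrite natr_sum big_add1 big_mkord; apply: eq_bigr => l _.
by rewrite natrM !subn1 addSn subSS.
Qed.

(** At $s=0$ the cluster series collapses to $(X-X^m)/(1-X^m)$. *)
Lemma cluster_gf_s0 m : (1 < m)%N ->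
  cluster_gf (0 : K) m =
  Fps (fun i => (i %% m == 1)%N%:R - ((0 < i) && (m %| i))%N%:R).
Proof.
move=> m_gt1; set E : fps K := Fps _.
have U : 1 - fpsC (0 - 1) * \sum_(1 <= l < m) t0 ^+ l \is a GRing.unit.
  exact: unit_1B_mul_sum.
have GX := geom_sum_nat t0 (ltnW m_gt1).
have EX : E * (1 - t0 ^+ m) = t0 - t0 ^+ m.
  apply/fpsP => i; rewrite mulrBr mulr1 !fpsDE !fpsNE fps_mulXnE fpsXnE.
  rewrite /E /=; case: (leqP m i) => [mi|im].
    have [k ->] : exists k, i = (m + k)%N by exists (i - m)%N; rewrite subnKC.
    rewrite addKn modnDl dvdn_addr // (_ : (0 < m + k)%N); last by lia.
    have -> : (m + k == 1)%N = false by apply/eqP; lia.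
    have -> : (m + k == m)%N = (k == 0)%N by apply/eqP/eqP; lia.
    by case: k => [|k] /=; rewrite ?mod0n ?dvdn0 /=; ring.
  rewrite modn_small // (ltn_eqF im) !subr0.
  by rewrite (_ : (_ && _) = false) ?subr0 //; case: posnP => //= i0; rewrite gtnNdvd.
apply: (mulIr (_ : 1 - t0 ^+ m \is a GRing.unit)).
  by rewrite fps_unitE fpsDE fpsNE fpsXnE fps1E (ltn_eqF (ltnW m_gt1)) subr0 unitr1.
have c1 : fpsC (0 - 1) = -1 :> fps K by rewrite sub0r rmorphN rmorph1.
rewrite EX /cluster_gf; rewrite c1 in U *.
set G := \sum_(1 <= l < m) _ in U GX *.
have -> : 1 - t0 ^+ m = (1 - -1 * G) * (1 - t0).
  by transitivity (1 - t0 + (1 - t0) * G); [rewrite GX; ring | ring].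
rewrite mulrA mulrDl divrK //.
transitivity (t0 * (1 - t0) + t0 * ((1 - t0) * G) - t0 ^+ m * (1 - t0)).
  by ring.
by rewrite GX; ring.
Qed.

End Explicit.

(** The only candidate for [j] is the quotient of [i] by [m], and [m <= i] says that it is
    positive. *)
Lemma sum_multiples (V : nmodType) (F : nat -> V) m r i : (r < m)%N ->
  \sum_(1 <= j < i.+1) (if i == (j * m + r)%N then F (j * m + r)%N else 0) =
  if (m <= i)%N && (i %% m == r)%N then F i else 0.
Proof.
move=> rm; case: ifPn => [/andP[mi /eqP ir]|H].
  have iE := divn_eq i m; rewrite ir in iE.
  have q0 : (0 < i %/ m)%N by rewrite divn_gt0 //; lia.
  rewrite (bigD1_seq (i %/ m)%N) /= ?iota_uniq //; last first.
    by rewrite mem_index_iota q0 ltnS leq_div.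
  rewrite -iE eqxx big1 ?addr0 //.
  move=> j jq; rewrite iE eqn_add2r eqn_pmul2r; last by lia.
  by rewrite eq_sym (negbTE jq).
rewrite big_nat big1 // => j /andP[j0 _]; case: eqP => // ij.
case/negP: H; rewrite ij modnMDl modn_small // eqxx andbT.
by rewrite -[m in (m <= _)%N]mul1n (leq_trans (leq_mul j0 (leqnn m))) ?leq_addr.
Qed.

(** By $1+z+\cdots+z^{m-1}=(1-z^m)/(1-z)$ the base of (b) is that of (a) at $s=0$; [0 - 1] is kept
    to match [cluster_series]. *)
Lemma no_occurrence_series (A : comUnitRingType) (t x z : A) m : (1 < m)%N ->
  1 - t \is a GRing.unit -> 1 + t \is a GRing.unit -> 1 - z ^+ m \is a GRing.unit ->
  z = (1 + t) * x / (1 - t) ->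
  2 * t * z * (1 - z ^+ m.-1) / ((1 - t ^+ 2) * (1 - z ^+ m)) =
  2 * t * x / (1 - t) ^+ 2 + 2 * t * (0 - 1) * z ^+ m
    / ((1 - t ^+ 2) * (1 - (0 - 1) * \sum_(1 <= l < m) z ^+ l)).
Proof.
move=> m_gt1 Ui Uj Um zE; have GX := geom_sum_nat z (ltnW m_gt1).
have EU : 1 - z ^+ m = (1 - (0 - 1) * \sum_(1 <= l < m) z ^+ l) * (1 - z).
  transitivity (1 - z + (1 - z) * \sum_(1 <= l < m) z ^+ l); last by ring.
  by rewrite GX; ring.
have /andP[UG _] : (1 - (0 - 1) * \sum_(1 <= l < m) z ^+ l \is a GRing.unit) &&
    (1 - z \is a GRing.unit) by rewrite -unitrM -EU.
rewrite cluster_series_factor // -zE; set G := \sum_(1 <= l < m) _ in UG GX EU *.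
have Ut : 1 - t ^+ 2 \is a GRing.unit.
  have -> : 1 - t ^+ 2 = (1 - t) * (1 + t) by ring.
  by rewrite unitrM Ui.
transitivity (2 * t / (1 - t ^+ 2) * (z * (1 - z ^+ m.-1) / (1 - z ^+ m))).
  by rewrite invrM //; ring.
congr (_ * _); apply: (mulIr Um); rewrite mulrVK // mulrBr mulr1.
rewrite -exprS prednK; last exact: ltnW.
rewrite EU mulrA mulrDl divrK //.
transitivity (z * (1 - z) + z * ((1 - z) * G) - z ^+ m * (1 - z)); last by ring.
by rewrite GX; ring.
Qed.

(** * The denominators of (c) *)

Section Denominator.
Variable m : nat.
Hypothesis m_gt1 : (1 < m)%N.
Local Notation y := (fpsX : fps rat).
Let c k j : fps rat :=
  (coef_c m j k)%:R * y ^+ (j * m) - (coef_c' m j k)%:R * y ^+ (j * m + 1).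

Lemma fps_natE (R : comNzRingType) n (f : fps R) i : (n%:R * f) i = n%:R * f i.
Proof. by rewrite -(rmorph_nat (@fpsC R)) fps_mulCE. Qed.

Lemma coef_term k j i :
  c k j i = (if i == (j * m + 0)%N then (coef_c m j k)%:R else 0)
          - (if i == (j * m + 1)%N then (coef_c' m j k)%:R else 0).
Proof.
rewrite /c fpsDE fpsNE !fps_natE !fpsXnE addn0.
by case: eqP => _; case: eqP => _; rewrite ?mulr1 ?mulr0.
Qed.

Lemma coef_term_high k j i : (i < j)%N -> c k j i = 0.
Proof.
move=> ij; rewrite coef_term !ifN_eq ?subr0 //; apply/eqP; nia.
Qed.

Lemma denominator_summable k : fps_summable 1 (c k).
Proof.
by apply: fps_summable_bound => i; exists i.+1 => j; apply: coef_term_high.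
Qed.

Lemma coef_c'E j k : coef_c' m j k =
  (2 * \sum_(1 <= l < k.+1)
     'C(l + (j * m + 1) - 1, l - 1) * 'C(j * m + 1 - 1, k - l))%N.
Proof.
by congr (_ * _)%N; apply: eq_bigr => l _; rewrite addn1 addnS !subn1.
Qed.

(** At $s=0$ clusters have weight 1 in degrees congruent to 1 modulo [m] and $-1$ in positive
    multiples of [m]. Degree 1 gives $2kx$, the others the terms with [coef_c'] and [coef_c]. *)
Lemma denominatorE k :
  1 - 2 * k%:R * y + fps_sum 1 (c k) = 1 - cluster_coef (0 : rat) m k.
Proof.
have u2 : (2 : rat) \is a GRing.unit by [].
rewrite -addrA; congr (_ + _); apply/fpsP => i.
rewrite fpsDE !fpsNE -natrM fps_natE.
rewrite (fps_sum_coef (N := i.+1)) => [|j _]; last exact: coef_term_high.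
under eq_bigr do rewrite coef_term; rewrite sumrB.
pose F n : rat := (2 * \sum_(1 <= l < k.+1) 'C(l + n - 1, l - 1) * 'C(n - 1, k - l))%:R.
pose F' i' r j := if i' == (j * m + r)%N then F (j * m + r)%N else 0.
rewrite (eq_big_nat _ _ (F2 := F' i 0)); last first.
  by move=> j _; rewrite /F' /F /coef_c addn0.
rewrite [X in _ - X](eq_big_nat _ _ (F2 := F' i 1)); last first.
  by move=> j _; rewrite coef_c'E.
rewrite !sum_multiples ?(ltnW m_gt1) //.
rewrite -[cluster_coef _ _ _ i]/(cluster_gf (0 : rat) m i * _).
case: i => [|i].
  by rewrite cluster_gf0 // mul0r !ifF ?leqn0 ?(gtn_eqF (ltnW m_gt1)) // subr0 mulr0.
rewrite chain_coef // -/(F i.+1) cluster_gf_s0 //.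
(* Only [l = k] survives, as $\binom{0}{k-l}$ vanishes otherwise. *)
have F1 : F 1 = (2 * k)%:R.
  rewrite /F; congr (_ * _)%:R; case: (k) => [|k']; first by rewrite big_geq.
  rewrite big_nat_recr //= big_nat big1 => [|l /andP[_ lk]].
    by rewrite subnn bin0 muln1 add0n addnK subn1 binSn.
  by rewrite (bin_small (_ : 0 < _ - l)%N) ?muln0 // subn_gt0.
have -> : (y : fps rat) i.+1 = (i.+1 == 1)%N%:R by [].
rewrite -F1 -[Fps _ _]/((i.+1 %% m == 1)%N%:R - (m %| i.+1)%N%:R) /dvdn.
have [mi|im] := leqP m i.+1.
  rewrite (gtn_eqF (leq_trans m_gt1 mi)) !andTb.
  by case: (altP (_ =P 0%N)) => [->|_]; case: eqP => _ /=; ring.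
by rewrite modn_small // !andFb; case: i im => [|i] im /=; ring.
Qed.

End Denominator.

(* Series in t (outer variable) whose coefficients are series in x (inner
   variable), over Q[s] in (a) and over Q in (b) and (c). *)
Theorem theorem4p5 (m : nat) (hm : (2 <= m)%N) :
  [/\
    (let t : fps (fps {poly rat}) := fpsX in
     let x : fps (fps {poly rat}) := fpsC fpsX in
     let s : fps (fps {poly rat}) := fpsC (fpsC 'X) in
     let u := 4 * t / (1 + t) ^+ 2 in
     let z := (1 + t) * x / (1 - t) in
     let Pz n := P_ipk (1%g : 'S_m) n s u * z ^+ n in
     let f := 2 * t * x / (1 - t) ^+ 2
              + 2 * t * (s - 1) * z ^+ m
                / ((1 - t ^+ 2) * (1 - (s - 1) * \sum_(1 <= l < m) z ^+ l)) in
     [/\ fps_summable2 1 Pz, fps_summable2 0 (hadamard_exp f)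
       & 1 / (1 - t) + (1 + t) / (2 * (1 - t)) * fps_sum2 1 Pz
         = fps_sum2 0 (hadamard_exp f)]),
    (let t : fps (fps rat) := fpsX in
     let x : fps (fps rat) := fpsC fpsX in
     let u := 4 * t / (1 + t) ^+ 2 in
     let z := (1 + t) * x / (1 - t) in
     let Pz n := P_ipk (1%g : 'S_m) n 0 u * z ^+ n in
     let f := 2 * t * z * (1 - z ^+ m.-1) / ((1 - t ^+ 2) * (1 - z ^+ m)) in
     [/\ fps_summable2 1 Pz, fps_summable2 0 (hadamard_exp f)
       & 1 / (1 - t) + (1 + t) / (2 * (1 - t)) * fps_sum2 1 Pz
         = fps_sum2 0 (hadamard_exp f)])
  & (let t : fps (fps rat) := fpsX in
     let x : fps (fps rat) := fpsC fpsX in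
     let u := 4 * t / (1 + t) ^+ 2 in
     let z := (1 + t) * x / (1 - t) in
     let Pz n := P_ipk (1%g : 'S_m) n 0 u * z ^+ n in
     let y : fps rat := fpsX in
     let c k j := (coef_c m j k)%:R * y ^+ (j * m)
                  - (coef_c' m j k)%:R * y ^+ (j * m + 1) in
     let d k := 1 - 2 * k%:R * y + fps_sum 1 (c k) in
     let Q k := fpsC (d k)^-1 * t ^+ k in
     [/\ fps_summable2 1 Pz,
         forall k, (1 <= k)%N -> fps_summable 1 (c k),
         fps_summable2 1 Q
       & 1 / (1 - t) + (1 + t) / (2 * (1 - t)) * fps_sum2 1 Pz
         = 1 + fps_sum2 1 Q])].
Proof.
have u2 : (2 : rat) \is a GRing.unit by [].
have u2X : (2 : {poly rat}) \is a GRing.unit.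
  by rewrite -(rmorph_nat (@polyC rat)) rmorph_unit.
have C0 : fpsC (fpsC 0) = 0 :> fps (fps rat) by rewrite !rmorph0.
split.
- exact: (peak_series 'X u2X hm).
- move=> t x u z Pz f.
  have [S1 S2 E] := peak_series (0 : rat) u2 hm.
  have fE : f = cluster_series (0 : rat) m.
    rewrite /cluster_series C0; apply: no_occurrence_series => //.
    exact: unit_1Bzm.
  move: S1 S2 E; rewrite C0 -fE => S1 S2 E.
  by split.
move=> t x u z Pz y c d Q.
have [S1 _ _] := peak_series (0 : rat) u2 hm.
have lhsE := lhs_coef (0 : rat) u2 hm.
rewrite C0 in S1 lhsE.
(* Each [Q k] lives in $t$-degree [k] alone, so a coefficient of the sum is a single inverse. *)
have Qn k n : (k != n)%N -> Q k n = 0.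
  by move=> kn; rewrite /Q fps_mulCE fpsXnE eq_sym (negbTE kn) mulr0.
split.
- exact: S1.
- by move=> k _; exact: denominator_summable.
- move=> n; apply: fps_summable_bound => i; exists n.+1 => k nk.
  by rewrite Qn ?fps0E // gtn_eqF.
apply/fpsP => n; rewrite lhsE fpsDE fps1E; apply/fpsP => i.
rewrite fpsDE [X in _ + X](fps_sum_coef (N := n.+1)) => [|k _ nk]; last first.
  by rewrite Qn ?fps0E // gtn_eqF.
case: n => [|n].
  (* For $n=0$ the alphabet is empty and only the empty word contributes. *)
  rewrite big_geq // addr0 /words_gf.
  by case: i => [|i]; rewrite /= ?big_seq1 ?big_nil ?run_occ_nil // ltnW.
rewrite big_nat_recr // big_nat big1; last first.
  by move=> k /andP[_ kn]; rewrite Qn ?fps0E // ltn_eqF.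
rewrite -[(n.+1 == 0)%N%:R]/(0 : fps rat) fps0E add0r [RHS]add0r.
rewrite /Q fps_mulCE fpsXnE eqxx mulr1.
suff -> : words_gf 0 m n.+1 = (d n.+1)^-1 by [].
have := words_gfE (0 : rat) u2 hm n.+1.
rewrite -denominatorE // -/(d n.+1) => Wd.
have Ud : d n.+1 \is a GRing.unit.
  by apply/unitrPr; exists (words_gf 0 m n.+1); rewrite mulrC.
by apply: (mulIr Ud); rewrite Wd mulVr.
Qed.
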